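(* Let $P_1,P_2\in\mathbb{C}[X]$ be nonzero polynomials vanishing at $0$, with multiplicities $\nu_1\ge\nu_2=\nu\ge1$ at $0$, and let $f_\lambda(z)=Q_\lambda(P_1(z),P_2(z))$ be the lacunary family described in the context, with Bautin index $b$. Assume that at least one of the following lacunarity conditions holds: - $\nu n_{\ell+1}>n_\ell D$ for all $0\le \ell\le \ell_d-1$; - $\nu_1=\nu_2$ and $\nu n_{\ell+1}>\nu n_\ell+(k+1)(\tau_\ell-1)$ for all $0\le\ell\le\ell_d-1$; - $\nu_1\ne\nu_2$ and $\bar\nu_{\ell+1}>\widetilde\nu_\ell$ for all $0\le\ell\le\ell_d-1$; - $\nu_1=\nu_2$ and for all $\ell,\ell'\in\{0,\dots,\ell_d\}$: if $\ell>\ell'$ and $\bar\nu_\ell\equiv\bar\nu_{\ell'}\pmod{k+1}$ then $\bar\nu_\ell>\bar\nu_{\ell'}+(k+1)(\tau_{\ell'}-1)$; - $\nu_1\neq\nu_2$ and for all $\ell,\ell'\in\{0,\dots,\ell_d\}$: if $\ell>\ell'$ and $\bar\nu_\ell\equiv\bar\nu_{\ell'}\pmod{|\nu_1-\nu_2|}$ then $\bar\nu_\ell>\widetilde\nu_{\ell'}$. Then: - if $\nu_1\ne\nu_2$, $\ b=\max_{0\le\ell\le\ell_d}\widetilde\nu_\ell$; - if $\nu_1=\nu_2=\nu$ and $P_1,P_2$ are not proportional, $\ b=\max_{0\le\ell\le\ell_d}\bigl(\nu n_\ell+(k+1)(\tau_\ell-1)\bigr)$; - if $P_1$ and $P_2$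 are proportional, $\ b=\bar\nu_{\ell_d}=\nu d$.
   Context: Curve. $D_i=\deg P_i\ge 1$, $D=\max(D_1,D_2)$. Write $P_1(X)=X^{\nu_1}\sum_{i=0}^{D_1-\nu_1}\alpha_iX^i$, $P_2(X)=X^{\nu_2}\sum_{i=0}^{D_2-\nu_2}a_iX^i$ with $\alpha_0,a_0\ne0$; coefficients with index beyond the degree are $0$. By convention (up to permuting the variables) $\nu_1\ge\nu_2$, and $\nu=\nu_2$. Lacunary family. Integers $0\le n_0<n_1<\dots<n_{\ell_d}=d$ are given, and for each $\ell\in\{0,\dots,\ell_d\}$ a nonempty set $T_\ell=\{t_{\ell,1}<\dots<t_{\ell,\tau_\ell}\}\subset\{1,\dots,n_\ell+1\}$. Set $m=\sum_{\ell=0}^{\ell_d}\tau_\ell$ and, for $\lambda=(\lambda_{\ell,i})\in\mathbb{C}^m$, $$Q_\lambda(X,Y)=\sum_{\ell=0}^{\ell_d}\sum_{i=1}^{\tau_\ell}\lambda_{\ell,i}X^{t_{\ell,i}-1}Y^{n_\ell-(t_{\ell,i}-1)},\qquad f_\lambda(z)=Q_\lambda(P_1(z),P_2(z))=\sum_{j=0}^{dD}v_j(\lambda)z^j,$$ where the $v_j$ are linear forms in $\lambda$. The Bautin index $b$ of the family is the largest index $j$ such that $v_j\notin\mathrm{Span}(v_0,\dots,v_{j-1})$. Notation. For each $\ell$: $\bar\nu_\ell=(t_{\ell,1}-1)\nu_1+(n_\ell-(t_{\ell,1}-1))\nu_2$ and $\widetilde\nu_\ell=(t_{\ell,\tau_\ell}-1)\nu_1+(n_\ell-(t_{\ell,\tau_\ell}-1))\nu_2$.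 If $\nu_1=\nu_2$, let $\mu=\alpha_0/a_0$; if $P_1,P_2$ are not proportional, $k\ge0$ is the largest integer such that $\alpha_i=\mu a_i$ for all $0\le i\le k$; if $P_1=\mu P_2$, $k=D-\nu$. *)

(* Defs.v *)
From HB Require Import structures.
From mathcomp Require Import all_boot all_order all_algebra.
From mathcomp Require Import reals complex.

Set Implicit Arguments.
Unset Strict Implicit.
Unset Printing Implicit Defensive.

Import Order.TTheory GRing.Theory Num.Theory.

Local Open Scope ring_scope.

(* [lexp l] is n_l, and [lsupp l] lists the elements t_{l,1} < ... < t_{l,tau}
   of T_l, a nonempty subset of {1, ..., n_l + 1}. *)
Record lacunary_family := LacunaryFamily {
  lmax : nat;
  lexp : 'I_lmax.+1 -> nat;
  lsupp : 'I_lmax.+1 -> seq nat;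
  lexp_incr : forall l l' : 'I_lmax.+1, (l < l')%N -> (lexp l < lexp l')%N;
  lsupp_neq0 : forall l, lsupp l != [::];
  lsupp_sorted : forall l, sorted ltn (lsupp l);
  lsupp_range : forall l, all (fun t => 1 <= t <= (lexp l).+1)%N (lsupp l)
}.

Definition fdeg (F : lacunary_family) : nat := lexp (ord_max : 'I_(lmax F).+1).

Definition tau (F : lacunary_family) (l : 'I_(lmax F).+1) : nat :=
  size (lsupp l).

(* The index is 0-based: [supp_nth l i] is t_{l,i+1}. *)
Definition supp_nth (F : lacunary_family) (l : 'I_(lmax F).+1) (i : nat) : nat :=
  nth 0%N (lsupp l) i.

(* This type has \sum_l tau l elements. *)
Definition lindex (F : lacunary_family) : finType :=
  {l : 'I_(lmax F).+1 & 'I_(tau l)}.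

(* [K^o] is [K] seen as a one-dimensional vector space over itself. *)
Definition lparam (K : fieldType) (F : lacunary_family) : vectType K :=
  {ffun lindex F -> K^o}.

(* Q_lambda(X, Y), for X and Y in an arbitrary commutative K-algebra. *)
Definition lacQ (K : fieldType) (F : lacunary_family) (A : comAlgType K)
    (lambda : lparam K F) (X Y : A) : A :=
  \sum_(l < (lmax F).+1) \sum_(i < tau l)
    (lambda (Tagged (fun l => 'I_(tau l)) i) : K) *:
      (X ^+ (supp_nth l i).-1 * Y ^+ (lexp l - (supp_nth l i).-1)).

Lemma lacQ_linear (K : fieldType) (F : lacunary_family) (A : comAlgType K)
    (X Y : A) (c : K) (u v : lparam K F) :
  lacQ (c *: u + v) X Y = c *: lacQ u X Y + lacQ v X Y.
Proof.
rewrite /lacQ scaler_sumr -big_split; apply: eq_bigr => l _ /=.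
rewrite scaler_sumr -big_split; apply: eq_bigr => i _ /=.
by rewrite !ffunE scalerDl scalerA.
Qed.

Definition lacf (K : fieldType) (F : lacunary_family) (P1 P2 : {poly K})
    (lambda : lparam K F) : {poly K} := lacQ lambda P1 P2.

Definition lacv_fun (K : fieldType) (F : lacunary_family) (P1 P2 : {poly K})
    (j : nat) (lambda : lparam K F) : K^o := (lacf P1 P2 lambda)`_j.

Fact lacv_fun_is_linear (K : fieldType) (F : lacunary_family)
    (P1 P2 : {poly K}) (j : nat) : linear (@lacv_fun K F P1 P2 j).
Proof.
move=> c u v.
transitivity ((c *: lacf P1 P2 u + lacf P1 P2 v)`_j); last by rewrite coefD coefZ.
by rewrite /lacv_fun /lacf lacQ_linear.
Qed.

HB.instance Definition _ (K : fieldType) (F : lacunary_family)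
    (P1 P2 : {poly K}) (j : nat) :=
  GRing.isLinear.Build K (lparam K F) K^o *:%R (@lacv_fun K F P1 P2 j)
    (@lacv_fun_is_linear K F P1 P2 j).

Definition lacv (K : fieldType) (F : lacunary_family) (P1 P2 : {poly K})
    (j : nat) : 'Hom(lparam K F, K^o) := linfun (@lacv_fun K F P1 P2 j).

Lemma lacvE (K : fieldType) (F : lacunary_family) (P1 P2 : {poly K})
    (j : nat) (lambda : lparam K F) :
  lacv F P1 P2 j lambda = (lacf P1 P2 lambda)`_j.
Proof. by rewrite lfunE. Qed.

Definition maxdeg (K : fieldType) (P1 P2 : {poly K}) : nat :=
  maxn (size P1).-1 (size P2).-1.

Definition lacv_new (K : fieldType) (F : lacunary_family) (P1 P2 : {poly K})
    (j : nat) : bool :=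
  lacv F P1 P2 j \notin <<[seq lacv F P1 P2 i | i <- iota 0 j]>>%VS.

(* See [bautin_indexP] below: the maximum is attained as soon as P1 and P2 are
   nonzero. *)
Definition bautin_index (K : fieldType) (F : lacunary_family)
    (P1 P2 : {poly K}) : nat :=
  \max_(j < (fdeg F * maxdeg P1 P2).+1 | lacv_new F P1 P2 j) j.

Definition proportional (K : fieldType) (P1 P2 : {poly K}) : Prop :=
  exists c : K, P1 = c *: P2.

Definition mult0 (K : fieldType) (P : {poly K}) : nat := mup 0 P.

(* The coefficients alpha_i of P1 and a_i of P2. *)
Definition shcoef (K : fieldType) (P : {poly K}) (i : nat) : K :=
  P`_(mult0 P + i).

Definition lead_ratio (K : fieldType) (P1 P2 : {poly K}) : K :=
  shcoef P1 0 / shcoef P2 0.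

(* The integer k, which is meaningful when P1 and P2 have the same multiplicity
   at 0; see [contact_orderP]. *)
Definition contact_order (K : fieldType) (P1 P2 : {poly K}) : nat :=
  let mu := lead_ratio P1 P2 in
  if P1 == mu *: P2 then (maxdeg P1 P2 - mult0 P2)%N
  else \max_(k < (maxdeg P1 P2).+1
             | [forall i : 'I_k.+1, shcoef P1 i == mu * shcoef P2 i]) k.

Definition nubar (K : fieldType) (F : lacunary_family) (P1 P2 : {poly K})
    (l : 'I_(lmax F).+1) : nat :=
  let s := (supp_nth l 0).-1 in (s * mult0 P1 + (lexp l - s) * mult0 P2)%N.

Definition nutilde (K : fieldType) (F : lacunary_family) (P1 P2 : {poly K})
    (l : 'I_(lmax F).+1) : nat :=
  let s := (supp_nth l (tau l).-1).-1 in
  (s * mult0 P1 + (lexp l - s) * mult0 P2)%N.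

Definition is_largest (A : nat -> Prop) (n : nat) : Prop :=
  A n /\ forall j, A j -> (j <= n)%N.

Lemma bigmax_largest (A : pred nat) (N : nat) :
    (exists j, A j) -> (forall j, A j -> (j <= N)%N) ->
  is_largest A (\max_(j < N.+1 | A j) j).
Proof.
move=> [j0 Aj0] AN; split; last first.
  move=> j Aj; have hj : (j < N.+1)%N by rewrite ltnS AN.
  exact: (@leq_bigmax_cond _ (fun j : 'I_N.+1 => A j) (fun j => j : nat) (Ordinal hj) Aj).
have hj0 : (j0 < N.+1)%N by rewrite ltnS AN.
have : (0 < #|[pred j : 'I_N.+1 | A j]|)%N.
  by apply/card_gt0P; exists (Ordinal hj0).
by case/(eq_bigmax_cond (fun j : 'I_N.+1 => j : nat)) => j Aj ->.
Qed.

Lemma mult0P (K : fieldType) (P : {poly K}) : P != 0 ->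
  exists2 Q : {poly K}, Q`_0 != 0 & P = 'X^(mult0 P) * Q.
Proof.
move=> P0; have := mup_geq 0 (mult0 P) P0; rewrite leqnn subr0 => /esym.
case/dvdpP=> Q PE; exists Q; last by rewrite mulrC.
apply/eqP=> Q0; have := mup_geq 0 (mult0 P).+1 P0; rewrite ltnn subr0 => /esym.
have /dvdpP[S QE] : 'X %| Q.
  by rewrite -['X]subr0 -polyC0 dvdp_XsubCl rootE horner_coef0 Q0.
by move/negbT/negP; apply; rewrite [X in _ %| X]PE QE -mulrA -exprS dvdp_mull.
Qed.

Lemma shcoef0_neq0 (K : fieldType) (P : {poly K}) : P != 0 -> shcoef P 0 != 0.
Proof.
move=> P0; case: (mult0P P0) => Q Q0 PE.
by rewrite /shcoef addn0 {1}PE coefXnM ltnn subnn.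
Qed.

Lemma coef_lt_mult0 (K : fieldType) (P : {poly K}) (i : nat) :
  P != 0 -> (i < mult0 P)%N -> P`_i = 0.
Proof. by move=> P0 hi; case: (mult0P P0) => Q _ ->; rewrite coefXnM hi. Qed.

Lemma contact_orderP (K : fieldType) (P1 P2 : {poly K}) :
    P1 != 0 -> P2 != 0 -> mult0 P1 = mult0 P2 -> ~ proportional P1 P2 ->
  is_largest
    (fun k => forall i, (i <= k)%N ->
       shcoef P1 i = lead_ratio P1 P2 * shcoef P2 i)
    (contact_order P1 P2).
Proof.
move=> P10 P20 e npr; rewrite /contact_order.
case: eqP => [E|_]; first by case: npr; exists (lead_ratio P1 P2).
set mu := lead_ratio P1 P2.
pose A k := [forall i : 'I_k.+1, shcoef P1 i == mu * shcoef P2 i].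
have AP k : A k <-> forall i, (i <= k)%N -> shcoef P1 i = mu * shcoef P2 i.
  split=> [/forallP Ak i hi|hk].
    exact/eqP/(Ak (Ordinal (hi : (i < k.+1)%N))).
  by apply/forallP=> i; apply/eqP/hk; rewrite -ltnS.
have A0 : A 0%N.
  apply/AP=> i; rewrite leqn0 => /eqP->.
  by rewrite /mu /lead_ratio divfK // shcoef0_neq0.
have AD j : A j -> (j <= maxdeg P1 P2)%N.
  move/AP=> hj; rewrite leqNgt; apply/negP=> ltD; apply: npr.
  exists mu; apply/polyP=> i; rewrite coefZ.
  have [lti|lei] := ltnP i (mult0 P2).
    by rewrite !coef_lt_mult0 ?e // mulr0.
  have [leD|ltDi] := leqP i (maxdeg P1 P2).
    have /hj : (i - mult0 P2 <= j)%N.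
      by rewrite (leq_trans (leq_subr _ _)) // (leq_trans leD) // ltnW.
    by rewrite /shcoef e subnKC.
  have szP (P : {poly K}) : ((size P).-1 < i)%N -> P`_i = 0.
    by move=> h; rewrite nth_default // (leq_trans (leqSpred _)).
  by rewrite !szP ?mulr0 // (leq_ltn_trans _ ltDi) // ?leq_maxl ?leq_maxr.
have [Ak hk] := bigmax_largest (ex_intro (fun j => is_true (A j)) _ A0) AD.
by split=> [|j hj]; [exact: (AP _).1 Ak | exact: hk ((AP _).2 hj)].
Qed.

Lemma size_expM_le (K : fieldType) (P1 P2 : {poly K}) (m s : nat) :
  (s <= m)%N -> (size (P1 ^+ s * P2 ^+ (m - s)%N : {poly K})%R <= (m * maxdeg P1 P2).+1)%N.
Proof.
move=> sm; apply: leq_trans (size_polyMleq _ _) _.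
have szX (P : {poly K}) k : ((size P).-1 <= maxdeg P1 P2)%N ->
    (size (P ^+ k)%R <= (k * maxdeg P1 P2).+1)%N.
  move=> h; apply: leq_trans (size_poly_exp_leq _ _) _.
  by rewrite ltnS mulnC leq_mul2l h orbT.
have h1 := szX P1 s (leq_maxl _ _).
have h2 := szX P2 (m - s)%N (leq_maxr _ _).
rewrite -[X in (_ <= (X * _).+1)%N](subnKC sm) mulnDl.
apply: leq_trans (_ : (_ <= ((s * maxdeg P1 P2).+1 +
   ((m - s) * maxdeg P1 P2).+1).-1)%N) _; last by rewrite addSn addnS.
by rewrite -!subn1 leq_sub2r // leq_add.
Qed.

Lemma supp_nth_le (F : lacunary_family) (l : 'I_(lmax F).+1) (i : nat) :
  ((supp_nth l i).-1 <= lexp l)%N.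
Proof.
rewrite -ltnS; have [lti|lei] := ltnP i (tau l); last first.
  by rewrite /supp_nth nth_default.
have /allP/(_ _ (mem_nth 0%N lti))/andP[t1 tn] := lsupp_range l.
by rewrite /supp_nth prednK.
Qed.

Lemma lexp_le_fdeg (F : lacunary_family) (l : 'I_(lmax F).+1) :
  (lexp l <= fdeg F)%N.
Proof.
have [->//|ne] := eqVneq l ord_max; apply/ltnW/lexp_incr.
by rewrite ltn_neqAle -ltnS ltn_ord andbT; apply: contraNneq ne => /val_inj->.
Qed.

Lemma size_lacf (K : fieldType) (F : lacunary_family) (P1 P2 : {poly K})
    (lambda : lparam K F) :
  (size (lacf P1 P2 lambda) <= (fdeg F * maxdeg P1 P2).+1)%N.
Proof.
apply: (leq_trans (size_sum _ _ _)); apply/bigmax_leqP=> l _.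
apply: (leq_trans (size_sum _ _ _)); apply/bigmax_leqP=> i _.
apply: leq_trans (size_scale_leq _ _) _.
apply: leq_trans (size_expM_le _ _ (supp_nth_le _ _)) _.
by rewrite ltnS leq_mul2r lexp_le_fdeg orbT.
Qed.

Lemma bautin_indexP (K : fieldType) (F : lacunary_family) (P1 P2 : {poly K}) :
    P1 != 0 -> P2 != 0 ->
  is_largest (lacv_new F P1 P2) (bautin_index F P1 P2).
Proof.
move=> P10 P20; apply: bigmax_largest; last first.
  move=> j; apply: contraNT; rewrite -ltnNge => ltj.
  suff -> : lacv F P1 P2 j = 0 by exact: mem0v.
  apply/lfunP=> lambda; rewrite lacvE zero_lfunE nth_default //.
  exact: leq_trans (size_lacf _ _ _) ltj.
pose N := (fdeg F * maxdeg P1 P2)%N.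
case: (boolP [exists j : 'I_N.+1, lacv_new F P1 P2 j]) => [/existsP[j ?]|].
  by exists j.
rewrite negb_exists => /forallP no.
have v0 j : lacv F P1 P2 j = 0.
  elim/ltn_ind: j => j IH; have [ltj|] := ltnP j N.+1; last first.
    move=> leN; apply/lfunP=> lambda; rewrite lacvE zero_lfunE nth_default //.
    exact: leq_trans (size_lacf _ _ _) leN.
  have := no (Ordinal ltj); rewrite negbK /= => hv.
  apply/eqP; rewrite -memv0; apply: subvP hv; apply/span_subvP=> _ /mapP[i hi ->].
  by rewrite IH ?mem0v //; move: hi; rewrite mem_iota add0n.
have t0 : (0 < tau (ord_max : 'I_(lmax F).+1))%N.
  by rewrite lt0n size_eq0 lsupp_neq0.
pose q : lindex F := Tagged (fun l => 'I_(tau l)) (Ordinal t0).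
pose lam : lparam K F := [ffun p => (p == q)%:R].
suff f0 : lacf P1 P2 lam != 0.
  by case/negP: f0; apply/eqP/polyP=> j; rewrite -lacvE v0 zero_lfunE coef0.
rewrite /lacf /lacQ (bigD1 ord_max) //= (bigD1 (Ordinal t0)) //=.
rewrite [X in _ + X + _]big1 ?addr0 => [|i ne]; last first.
  by rewrite ffunE eq_Tagged /= (negbTE ne) scale0r.
rewrite [X in _ + X]big1 ?addr0 => [|l ne]; last first.
  apply: big1 => i _; rewrite ffunE -tag_eqE /tag_eq /= (negbTE ne).
  by rewrite scale0r.
by rewrite ffunE eqxx scale1r mulf_neq0 // expf_neq0.
Qed.

(* Main.v *)
Require Import Defs.
From mathcomp Require Import all_boot all_order all_algebra.
From mathcomp Require Import reals complex.
From mathcomp Require Import zify ring.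

(* By linear duality, [v_j] is not in the span of the earlier [v_i] iff some
   [f_lambda] vanishes at 0 to order exactly [j]; so [b] is the largest order of
   a nonzero [f_lambda].  It is read off a basis of the parameters whose images
   have pairwise distinct orders.  If [nu1 <> nu2], the images are the monomials
   [P1 ^+ s * P2 ^+ (n - s)].  If [nu1 = nu2] and [P1], [P2] are not
   proportional, then [P1 - mu P2] has order [nu + k + 1], and for every
   [j < tau] some combination of the [tau] monomials [X^s] of a level has a root
   of order exactly [j] at [mu <> 0]; homogenized, it gives order
   [nu n + (k + 1) j].  The lacunarity conditions keep the orders of different
   levels distinct.  If [P1 = c P2], the powers [P2 ^+ n] span the [f_lambda],
   and no lacunarity is needed. *)

Set Implicit Arguments.
Unset Strict Implicit.
Unset Printing Implicit Defensive.

Import Order.TTheory GRing.Theory Num.Theory.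

Local Open Scope ring_scope.

(** * Linear forms: spans and kernels *)

Lemma mem_span_bigcap_lker (K : fieldType) (V : vectType K)
    (s : seq 'Hom(V, K^o)) (u : 'Hom(V, K^o)) :
  (\bigcap_(v <- s) lker v <= lker u)%VS -> u \in <<s>>%VS.
Proof.
elim: s u => [|v s IHs] u.
  rewrite big_nil => /subvP keru; rewrite span_nil memv0.
  by apply/eqP/lfunP=> x; rewrite zero_lfunE; apply/eqP;
    rewrite -memv_ker keru ?memvf.
rewrite big_cons => kersub; rewrite span_cons.
have [vs|/subvPn[x0 kerx0]] := boolP (\bigcap_(v0 <- s) lker v0 <= lker v)%VS.
  apply: (subvP (addvSr _ _)); apply: IHs; apply: subv_trans kersub.
  by rewrite subv_cap vs subvv.
rewrite memv_ker => vx0.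
rewrite -(subrK ((u x0 / v x0 : K) *: v) u) addrC.
apply: memv_add; first by rewrite memvZ ?memv_line.
apply: IHs; apply/subvP=> x kerx.
have : x - (v x / v x0 : K) *: x0 \in lker u.
  apply: (subvP kersub); rewrite memv_cap; apply/andP; split; last first.
    by rewrite rpredB ?rpredZ.
  by rewrite memv_ker linearB linearZ /= /GRing.scale /= divfK ?subrr.
rewrite !memv_ker linearB linearZ /= => /eqP/subr0_eq ux.
rewrite add_lfunE opp_lfunE scale_lfunE ux /GRing.scale /=.
by rewrite mulrAC -mulrA [v x * _]mulrC mulrAC subrr.
Qed.

(** * Order of vanishing at 0 *)

(** A relation rather than a function, so that the zero polynomial has no order at all. *)
Definition has_order (K : fieldType) (p : {poly K}) (n : nat) : Prop :=
  exists2 q : {poly K}, q`_0 != 0 & p = 'X^n * q.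

Lemma has_orderP (K : fieldType) (p : {poly K}) (n : nat) :
  has_order p n <-> p`_n != 0 /\ forall i, (i < n)%N -> p`_i = 0.
Proof.
split=> [[q q0 ->]|[pn p0]].
  by split=> [|i ltin]; rewrite coefXnM ?ltnn ?subnn ?ltin.
exists (drop_poly n p); first by rewrite coef_drop_poly add0n.
rewrite -{1}(poly_take_drop n p) mulrC [take_poly n p](_ : _ = 0) ?add0r //.
by apply/polyP=> i; rewrite coef_take_poly coef0; case: ifP => // /p0.
Qed.

Lemma has_order_uniq (K : fieldType) (p : {poly K}) (m n : nat) :
  has_order p m -> has_order p n -> m = n.
Proof.
move=> /has_orderP[pm p0m] /has_orderP[pn p0n].
by case: (ltngtP m n) => // [/p0n p0|/p0m p0]; move: pm pn; rewrite p0 eqxx.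
Qed.

Lemma has_order_neq0 (K : fieldType) (p : {poly K}) (n : nat) :
  has_order p n -> p != 0.
Proof. by case/has_orderP=> + _; apply: contraNneq => ->; rewrite coef0. Qed.

Lemma has_orderM (K : fieldType) (p q : {poly K}) (m n : nat) :
  has_order p m -> has_order q n -> has_order (p * q) (m + n).
Proof.
move=> [p' p'0 ->] [q' q'0 ->]; exists (p' * q'); last by rewrite mulrACA exprD.
by rewrite coef0M mulf_neq0.
Qed.

Lemma has_orderX (K : fieldType) (p : {poly K}) (m n : nat) :
  has_order p m -> has_order (p ^+ n) (n * m).
Proof.
move=> ordp; elim: n => [|n IHn]; last by rewrite exprS mulSn; apply: has_orderM.
by exists 1; rewrite ?mulr1 ?coef1 ?oner_neq0.
Qed.

(* The term of smallest order among those with a nonzero coefficient cannot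
   cancel. *)
Lemma has_order_comb (K : fieldType) (I : finType) (h : I -> {poly K})
    (w : I -> nat) (c : I -> K) :
    injective w -> (forall i, has_order (h i) (w i)) ->
    (exists i, c i != 0) ->
  exists i, has_order (\sum_i c i *: h i) (w i).
Proof.
move=> w_inj ordh [i0 ci0].
case: (@arg_minnP I i0 (fun i => c i != 0) w ci0) => i ci imin; exists i.
have hP j : (w i < w j)%N -> forall t, (t <= w i)%N -> (h j)`_t = 0.
  move=> ltij t leti; have [_ ->] := (has_orderP _ _).1 (ordh j) => //.
  exact: leq_ltn_trans leti ltij.
have [hii hi0] := (has_orderP _ _).1 (ordh i).
have lt_w j : j != i -> c j != 0 -> (w i < w j)%N.
  move=> ji cj; rewrite ltn_neqAle imin // andbT.
  by apply: contraNneq ji => /w_inj->.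
apply/has_orderP; split=> [|t ltti]; rewrite coef_sum.
  rewrite (bigD1 i) //= big1 ?addr0 => [|j ji]; first by rewrite coefZ mulf_neq0.
  rewrite coefZ; have [->|cj] := eqVneq (c j) 0; first by rewrite mul0r.
  by rewrite (hP j) ?mulr0 // lt_w.
apply: big1 => j _; rewrite coefZ.
have [->|cj] := eqVneq (c j) 0; first by rewrite mul0r.
have [->|ji] := eqVneq j i; first by rewrite hi0 ?mulr0.
by rewrite (hP j) ?mulr0 ?lt_w // ltnW.
Qed.

(** * The Bautin index as a largest order *)

(** The earlier forms all vanish at such a [lambda], hence so does their span; conversely,
    [mem_span_bigcap_lker] yields a parameter killed by the earlier forms but not by [v_j]. *)
Lemma lacv_newP (K : fieldType) (F : lacunary_family) (P1 P2 : {poly K})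
    (j : nat) :
  lacv_new F P1 P2 j <->
  exists lambda : lparam K F, has_order (lacf P1 P2 lambda) j.
Proof.
split=> [|[lambda /has_orderP[fj f0]]]; last first.
  set s := [seq lacv F P1 P2 i | i <- iota 0 j].
  apply/negP=> /(@coord_span _ _ _ (in_tuple s))/lfunP/(_ lambda)/eqP.
  rewrite lacvE sum_lfunE big1 ?(negPf fj) // => i _.
  rewrite scale_lfunE /=; have /mapP[t] : s`_i \in s by rewrite mem_nth.
  by rewrite mem_iota add0n => ltj ->; rewrite lacvE f0 ?scaler0.
move/(contra (@mem_span_bigcap_lker _ _ _ _))/subvPn=> [lambda ker].
rewrite memv_ker lacvE => fj; exists lambda; apply/has_orderP; split=> // i ltij.
suff : lambda \in lker (lacv F P1 P2 i) by rewrite memv_ker lacvE => /eqP.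
apply: subvP ker.
rewrite (big_rem (lacv F P1 P2 i)) ?capvSl //.
by apply: map_f; rewrite mem_iota.
Qed.

(** By [has_order_comb], every nonzero image has one of the orders [w i], and each of these is
    attained. The type [I] need not index the parameters: in the proportional case it indexes the
    levels. *)
Lemma bautin_index_span (K : fieldType) (F : lacunary_family)
    (P1 P2 : {poly K}) (I : finType) (h : I -> {poly K}) (w : I -> nat) :
    P1 != 0 -> P2 != 0 -> injective w -> (forall i, has_order (h i) (w i)) ->
    (forall i, exists lambda : lparam K F, lacf P1 P2 lambda = h i) ->
    (forall lambda : lparam K F,
       exists c : I -> K, lacf P1 P2 lambda = \sum_i c i *: h i) ->
  bautin_index F P1 P2 = \max_i w i.
Proof.
move=> P10 P20 w_inj ordh h_im im_h.
have [/lacv_newP[lambda ordb] b_max] := bautin_indexP F P10 P20.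
apply/eqP; rewrite eqn_leq; apply/andP; split; last first.
  apply/bigmax_leqP=> i _; apply/b_max/lacv_newP.
  by have [lambda' e] := h_im i; exists lambda'; rewrite e.
have [c fE] := im_h lambda; have [c0|] := boolP [forall i, c i == 0].
  have := has_order_neq0 ordb; rewrite fE big1 ?eqxx // => i _.
  by rewrite (eqP (forallP c0 i)) scale0r.
rewrite negb_forall => /existsP c_neq0.
have [//|i ordi] := has_order_comb (c := c) w_inj ordh.
rewrite fE in ordb; rewrite (has_order_uniq ordb ordi).
exact: leq_bigmax.
Qed.

Lemma lacf0 (K : fieldType) (F : lacunary_family) (P1 P2 : {poly K}) :
  lacf P1 P2 (0 : lparam K F) = 0.
Proof.
have := lacQ_linear P1 P2 (-1) (0 : lparam K F) 0.
by rewrite scaler0 addr0 scaleN1r addNr.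
Qed.

Lemma lacf_comb (K : fieldType) (F : lacunary_family) (P1 P2 : {poly K})
    (I : finType) (c : I -> K) (g : I -> lparam K F) :
  lacf P1 P2 (\sum_i c i *: g i) = \sum_i c i *: lacf P1 P2 (g i).
Proof.
elim/big_rec2: _ => [|i p u _ <-]; first exact: lacf0.
exact: lacQ_linear.
Qed.

(* Parameters whose images have distinct orders are linearly independent, so
   as many of them as there are parameters form a basis. *)
Lemma bautin_index_basis (K : fieldType) (F : lacunary_family)
    (P1 P2 : {poly K}) (g : lindex F -> lparam K F) (w : lindex F -> nat) :
    P1 != 0 -> P2 != 0 -> injective w ->
    (forall p, has_order (lacf P1 P2 (g p)) (w p)) ->
  bautin_index F P1 P2 = \max_p w p.
Proof.
move=> P10 P20 w_inj ordg; apply: (bautin_index_span P10 P20 w_inj ordg).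
  by move=> p; exists (g p).
pose X := [tuple g (enum_val i) | i < #|lindex F|].
have X_nth (i : 'I_#|lindex F|) : X`_i = g (enum_val i).
  by rewrite -tnth_nth tnth_mktuple.
have X_free : free X.
  (* A vanishing combination has image zero, which has no order; a nonzero coefficient would give it
     one. *)
  apply/freeP=> c c0 i; apply/eqP; apply: contraT => ci.
  have [|p] := has_order_comb (c := c \o enum_rank) w_inj ordg.
    by exists (enum_val i); rewrite /= enum_valK.
  move/has_order_neq0; rewrite -lacf_comb.
  rewrite (reindex (fun i : 'I_#|lindex F| => enum_val i)) /=;
    last exact/onW_bij/enum_val_bij.
  rewrite (eq_bigr (fun i => c i *: X`_i)) => [|t _]; last first.
    by rewrite enum_valK X_nth.
  by rewrite c0 lacf0 eqxx.
have X_basis : basis_of fullv X.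
  rewrite basisEfree X_free subvf dimvf size_tuple.
  by rewrite /dim /= muln1.
move=> lambda; exists (fun p => coord X (enum_rank p) lambda).
rewrite {1}(coord_basis X_basis (memvf lambda)) -lacf_comb.
rewrite [in RHS](reindex (fun i : 'I_#|lindex F| => enum_val i)) /=;
    last exact/onW_bij/enum_val_bij.
by congr lacf; apply: eq_bigr => i _; rewrite enum_valK X_nth.
Qed.

(** * Lacunary polynomials with a root of prescribed order *)

(** The coefficients form column [j] of the inverse Vandermonde matrix, which exists because the
    nodes are distinct. *)
Lemma Vandermonde_dual (K : fieldType) (n : nat) (x : 'I_n -> K) (j : 'I_n) :
    injective x ->
  exists c : 'I_n -> K, forall i : 'I_n, \sum_m c m * x m ^+ i = (i == j)%:R.
Proof.
move=> x_inj; pose V := Vandermonde n (\row_i x i).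
have V_unit : V \in unitmx.
  rewrite unitmxE det_Vandermonde unitfE prodf_seq_neq0; apply/allP=> i _ /=.
  rewrite prodf_seq_neq0; apply/allP=> t _; apply/implyP=> ltit.
  rewrite !mxE subr_eq0 (inj_eq x_inj).
  by apply: contraTneq ltit => ->; rewrite ltnn.
exists (fun m => invmx V m j) => i.
have := congr1 (fun A : 'M_n => A i j) (mulmxV V_unit); rewrite !mxE => <-.
by apply: eq_bigr => m _; rewrite !mxE mulrC.
Qed.

(* The Euler operator [X d/dX], for which monomials are eigenvectors. *)
Definition euler (R : nzRingType) (p : {poly R}) : {poly R} := 'X * p^`().

Lemma iter_euler_sum (R : comNzRingType) (n : nat) (s : 'I_n -> nat)
    (c : 'I_n -> R) (i : nat) :
  iter i (@euler R) (\sum_m c m *: 'X^(s m)) =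
  \sum_m (c m * (s m)%:R ^+ i) *: 'X^(s m).
Proof.
elim: i => [|i /= ->]; first by apply: eq_bigr => m _; rewrite mulr1.
rewrite /euler raddf_sum mulr_sumr; apply: eq_bigr => m _ /=.
rewrite derivZ derivXn -scalerAr exprSr mulrA -scalerA; congr (_ *: _).
(* The exponent [0] is apart: multiplying by ['X] undoes the shift of the derivative only for
   positive exponents, and at [0] both sides vanish. *)
case: (s m) => [|t]; first by rewrite mulr0n mulr0 scale0r.
by rewrite mulrnAr -exprS scaler_nat.
Qed.

(** Each application lowers the order at [mu] by exactly one: the new cofactor takes at [mu] the
    value [mu * e.+1%:R * q'.[mu]], nonzero because [mu != 0] and the characteristic is zero. *)
Lemma iter_euler_XsubC (K : numFieldType) (mu : K) (q : {poly K})
    (i e : nat) : mu != 0 -> q.[mu] != 0 ->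
  exists2 q' : {poly K}, q'.[mu] != 0 &
    iter i (@euler K) (('X - mu%:P) ^+ (i + e) * q) = ('X - mu%:P) ^+ e * q'.
Proof.
move=> mu0 qmu; elim: i e => [|i IHi] e; first by exists q.
have [q' q'mu E] := IHi e.+1; rewrite iterS addSnnS E.
exists ('X * (e.+1%:R *: q' + ('X - mu%:P) * q'^`())).
  by rewrite !hornerE subrr mul0r addr0 !mulf_neq0 ?pnatr_eq0.
rewrite /euler derivM deriv_exp derivXsubC mul1r /= exprS -mul_polyC polyC_natr.
ring.
Qed.

(** The coefficients are chosen so that, among the iterates of [euler] of index below [n], only the
    one of index [j] is nonzero at [mu]. By [iter_euler_XsubC], the first iterate not vanishing at
    [mu] has the multiplicity of [mu] as its index, so this multiplicity is [j]. *)
Lemma lacunary_multiple_root (K : numFieldType) (mu : K) (n : nat)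
    (s : 'I_n -> nat) (j : 'I_n) : mu != 0 -> injective s ->
  exists c : 'I_n -> K, exists2 q : {poly K}, q.[mu] != 0 &
    \sum_m c m *: 'X^(s m) = ('X - mu%:P) ^+ j * q.
Proof.
move=> mu0 s_inj.
have [|c cE] := @Vandermonde_dual K n (fun m => (s m)%:R) j.
  by move=> m m' /eqP; rewrite eqr_nat => /eqP/s_inj.
(* Dividing by [mu ^+ s m] cancels the value of ['X^(s m)] at [mu]. *)
exists (fun m => c m / mu ^+ s m); set p := \sum_m _.
have eulerp (i : 'I_n) : (iter i (@euler K) p).[mu] = (i == j)%:R.
  rewrite iter_euler_sum horner_sum -cE; apply: eq_bigr => m _.
  by rewrite hornerZ hornerXn mulrAC mulfVK ?expf_neq0.
have p0 : p != 0.
  apply: contraTneq isT => p0; have := eulerp j; rewrite eqxx => /eqP.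
  rewrite [X in X.[_]](_ : _ = 0) ?horner0 1?eq_sym ?oner_eq0 //.
  elim: (val j) => [|i /= ->]; first exact: p0.
  by rewrite /euler raddf0 mulr0.
have [e [q]] := multiplicity_XsubC p mu; rewrite p0 /= mulrC => qmu pE.
suff <- : e = j by exists q.
case: (ltngtP e j) => // [ltej|ltje].
  have lten := ltn_trans ltej (ltn_ord j).
  have [q' q'mu] := iter_euler_XsubC e 0 mu0 qmu.
  rewrite addn0 mul1r -pE => E; have := eulerp (Ordinal lten).
  rewrite /= E -val_eqE /= ltn_eqF // => q'0.
  by rewrite q'0 eqxx in q'mu.
have [q' q'mu] := iter_euler_XsubC j (e - j) mu0 qmu.
rewrite subnKC -?pE 1?ltnW // => E; have := eulerp j; rewrite eqxx E => /eqP.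
rewrite hornerM horner_exp !hornerE subrr expr0n subn_eq0 leqNgt ltje mul0r.
by rewrite eq_sym oner_eq0.
Qed.

(** * Homogenization *)

(** This is $Y^n p(X/Y)$ without division; coefficients of [p] beyond index [n] are dropped. *)
Definition homog (A : comNzRingType) (n : nat) (p X Y : {poly A}) : {poly A} :=
  \sum_(i < n.+1) p`_i *: (X ^+ i * Y ^+ (n - i)).

Lemma homog_sum (A : comNzRingType) (n m : nat) (s : 'I_m -> nat)
    (c : 'I_m -> A) (X Y : {poly A}) : (forall i, (s i <= n)%N) ->
  homog n (\sum_i c i *: 'X^(s i)) X Y =
  \sum_i c i *: (X ^+ s i * Y ^+ (n - s i)).
Proof.
move=> sn; rewrite /homog.
under eq_bigr do rewrite coef_sum scaler_suml.
rewrite exchange_big; apply: eq_bigr => i _ /=.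
have ltsn : (s i < n.+1)%N by rewrite ltnS.
rewrite (bigD1 (Ordinal ltsn)) //= coefZ coefXn eqxx mulr1 big1 ?addr0 // => t.
by rewrite -val_eqE /= => /negPf nts; rewrite coefZ coefXn nts mulr0 scale0r.
Qed.

(** Multiplying [p] by ['X] adds a factor [X] to each term, and raising the degree by one adds a
    factor [Y]; the size bound kills the coefficient of [p] at the new top index. *)
Lemma homog_XsubC (A : comNzRingType) (n : nat) (mu : A) (p X Y : {poly A}) :
  (size p <= n.+1)%N ->
  homog n.+1 (('X - mu%:P) * p) X Y = (X - mu *: Y) * homog n p X Y.
Proof.
move=> szp.
have -> : homog n.+1 (('X - mu%:P) * p) X Y =
    homog n.+1 ('X * p) X Y - homog n.+1 (mu *: p) X Y.
  rewrite /homog -sumrB; apply: eq_bigr => i _.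
  by rewrite mulrBl mul_polyC coefB scalerBl.
rewrite mulrBl; congr (_ - _); rewrite /homog mulr_sumr.
  rewrite big_ord_recl coefXM scale0r add0r; apply: eq_bigr => i _.
  by rewrite coefXM /= subSS exprS -mulrA scalerAr.
rewrite big_ord_recr /= coefZ nth_default // mulr0 scale0r addr0.
apply: eq_bigr => i _; rewrite coefZ subSn -1?ltnS // exprS.
by rewrite mulrCA -scalerAl -!scalerAr scalerA.
Qed.

Lemma homog_XsubC_exp (A : idomainType) (j m : nat) (mu : A)
    (q X Y : {poly A}) : (size q <= m.+1)%N ->
  homog (j + m) (('X - mu%:P) ^+ j * q) X Y = (X - mu *: Y) ^+ j * homog m q X Y.
Proof.
move=> szq; elim: j => [|j IHj]; first by rewrite !mul1r.
rewrite !exprS -!mulrA -IHj homog_XsubC //.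
have [->|q0] := eqVneq q 0; first by rewrite mulr0 size_poly0.
rewrite size_monicM ?monic_exp ?monicXsubC // size_exp_XsubC addSn /= -addnS.
by rewrite leq_add2l.
Qed.

(** Write [X] and [Y] as ['X^n] times [A] and [B]. By homogeneity a factor ['X^(m * n)] comes out,
    and as the constant term of [A] is [mu] times that of [B], the other factor has as constant term
    [q.[mu]] times the [m]-th power of that of [B]. *)
Lemma has_order_homog (K : fieldType) (n m : nat) (mu : K) (q X Y : {poly K}) :
    (size q <= m.+1)%N -> q.[mu] != 0 -> has_order Y n -> X`_n = mu * Y`_n ->
    (forall i, (i < n)%N -> X`_i = 0) ->
  has_order (homog m q X Y) (m * n).
Proof.
move=> szq qmu [B B0 ->] XB X0.
rewrite coefXnM ltnn subnn in XB.
have [A -> A0] : exists2 A : {poly K}, X = 'X^n * A & A`_0 = mu * B`_0.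
  exists (drop_poly n X); last by rewrite coef_drop_poly.
  rewrite -{1}(poly_take_drop n X) mulrC [take_poly n X](_ : _ = 0) ?add0r //.
  by apply/polyP=> i; rewrite coef_take_poly coef0; case: ifP => // /X0.
exists (homog m q A B); last first.
  rewrite /homog mulr_sumr; apply: eq_bigr => i _.
  rewrite -scalerAr; congr (_ *: _); rewrite !exprMn mulrACA -exprD subnKC -1?ltnS // -exprM mulnC mulrA.
  by [].
have -> : (homog m q A B)`_0 = q.[mu] * B`_0 ^+ m.
  rewrite (horner_coef_wide _ szq) mulr_suml coef_sum; apply: eq_bigr => i _.
  rewrite -!horner_coef0 !hornerE !horner_coef0 A0 exprMn.
  have -> : B`_0 ^+ m = B`_0 ^+ i * B`_0 ^+ (m - i).
    by rewrite -exprD subnKC ?leq_ord.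
  by rewrite /=; ring.
by rewrite mulf_neq0 ?expf_neq0.
Qed.

(** * Supports and separation of the levels *)

Lemma supp_pred_lt (F : lacunary_family) (l : 'I_(lmax F).+1) (i j : nat) :
  (i < j)%N -> (j < tau l)%N -> ((supp_nth l i).-1 < (supp_nth l j).-1)%N.
Proof.
move=> ltij ltj; have lti := ltn_trans ltij ltj.
have := sorted_ltn_nth ltn_trans 0%N (lsupp_sorted l) i j lti ltj ltij.
have /allP/(_ _ (mem_nth 0%N lti))/andP[] := lsupp_range l.
by rewrite /supp_nth /=; lia.
Qed.

Lemma supp_pred_inj (F : lacunary_family) (l : 'I_(lmax F).+1) :
  injective (fun i : 'I_(tau l) => (supp_nth l i).-1).
Proof.
move=> i j /eqP; have [ltij|ltji|/val_inj//] := ltngtP i j.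
  by rewrite ltn_eqF // supp_pred_lt.
by rewrite gtn_eqF // supp_pred_lt.
Qed.

Lemma tau_gt0 (F : lacunary_family) (l : 'I_(lmax F).+1) : (0 < tau l)%N.
Proof. by rewrite lt0n size_eq0 lsupp_neq0. Qed.

Lemma tau_le (F : lacunary_family) (l : 'I_(lmax F).+1) :
  (tau l - 1 <= lexp l)%N.
Proof.
have T0 := tau_gt0 l; apply: leq_trans (supp_nth_le l (tau l).-1).
(* A strictly increasing sequence of naturals dominates its index. *)
suff H i : (i < tau l)%N -> (i <= (supp_nth l i).-1)%N by rewrite subn1 H ?prednK.
elim: i => [//|i IHi] lti; apply: leq_ltn_trans (IHi _) (supp_pred_lt _ lti) => //.
exact: ltnW.
Qed.

(** Passes from consecutive levels to all pairs, by chaining the inequalities through [lo <= hi] at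
    the intermediate levels. *)
Lemma consecutive_lt (n : nat) (lo hi : 'I_n.+1 -> nat) :
    (forall l, (lo l <= hi l)%N) ->
    (forall l l' : 'I_n.+1, l' = l.+1 :> nat -> (hi l < lo l')%N) ->
  forall l l' : 'I_n.+1, (l' < l)%N -> (hi l' < lo l)%N.
Proof.
move=> lohi step l l'; have [m] := ubnP l; elim: m l => // m IHm l ltlm lt_l'l.
have l1 : (l.-1 < n.+1)%N by rewrite (leq_ltn_trans (leq_pred _)).
have ltl : (hi (Ordinal l1) < lo l)%N by apply: step; rewrite /= prednK //; lia.
have [e|ne] := eqVneq l' (Ordinal l1); first by rewrite e.
apply: ltn_trans (IHm (Ordinal l1) _ _) (leq_ltn_trans (lohi _) ltl) => /=.
  by lia.
by move: ne; rewrite -val_eqE /=; lia.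
Qed.

Definition level_index (F : lacunary_family) (l : 'I_(lmax F).+1)
    (i : 'I_(tau l)) : lindex F := Tagged (fun l => 'I_(tau l)) i.

(** All orders of a level are congruent to [lo] modulo [M], so two levels can only collide when
    their values of [lo] are congruent, and then [sep] makes the intervals from [lo] to [hi]
    disjoint. *)
Lemma level_orders_inj (F : lacunary_family) (M : nat)
    (lo hi : 'I_(lmax F).+1 -> nat) (w : lindex F -> nat) :
    (forall l, injective (fun i : 'I_(tau l) => w (level_index i))) ->
    (forall p, lo (tag p) <= w p <= hi (tag p))%N ->
    (forall p, w p = lo (tag p) %[mod M]) ->
    (forall l l' : 'I_(lmax F).+1, (l' < l)%N ->
       lo l = lo l' %[mod M] -> (hi l' < lo l)%N) ->
  injective w.
Proof.
move=> winj wlohi wM sep p q e.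
have mod_e : lo (tag p) = lo (tag q) %[mod M] by rewrite -!wM e.
have := wlohi p; have := wlohi q; rewrite e => /andP[loq qhi] /andP[lop phi].
have [ltpq|ltqp|/val_inj etag] := ltngtP (tag p) (tag q).
- have := leq_trans (sep _ _ ltpq (esym mod_e)) (leq_trans loq phi).
  by rewrite ltnn.
- have := leq_trans (sep _ _ ltqp mod_e) (leq_trans lop qhi).
  by rewrite ltnn.
case: p q etag e {mod_e loq qhi lop phi} => [l i] [l' i'] /= etag e.
by subst l'; rewrite (winj l i i' e).
Qed.

Lemma level_orders_max (F : lacunary_family) (hi : 'I_(lmax F).+1 -> nat)
    (w : lindex F -> nat) :
    (forall p, w p <= hi (tag p))%N ->
    (forall l, exists i : 'I_(tau l), w (level_index i) = hi l) ->
  \max_p w p = \max_l hi l.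
Proof.
move=> whi wl; apply/eqP; rewrite eqn_leq; apply/andP; split.
  apply/bigmax_leqP=> p _; apply: leq_trans (whi p) _; exact: leq_bigmax.
by apply/bigmax_leqP=> l _; have [i <-] := wl l; apply: leq_bigmax.
Qed.

Definition last_tau (F : lacunary_family) (l : 'I_(lmax F).+1) : 'I_(tau l) :=
  Ordinal (etrans (ltn_predL _) (tau_gt0 l)).

Definition level_param (K : fieldType) (F : lacunary_family)
    (l : 'I_(lmax F).+1) (c : 'I_(tau l) -> K) : lparam K F :=
  [ffun p => untag 0 c p].

Lemma lacf_level (K : fieldType) (F : lacunary_family) (P1 P2 : {poly K})
    (l : 'I_(lmax F).+1) (c : 'I_(tau l) -> K) :
  lacf P1 P2 (level_param c) =
  \sum_i c i *: (P1 ^+ (supp_nth l i).-1 * P2 ^+ (lexp l - (supp_nth l i).-1)).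
Proof.
rewrite /lacf /lacQ (bigD1 l) //= [X in _ + X]big1 ?addr0 => [|l' nl].
  by apply: eq_bigr => i _; rewrite ffunE untagE.
by apply: big1 => i _; rewrite ffunE untag_dflt ?scale0r //= .
Qed.

(** * Multiplicities and the contact order *)

Lemma has_order_mult0 (K : fieldType) (P : {poly K}) :
  P != 0 -> has_order P (mult0 P).
Proof. exact: mult0P. Qed.

(** The coefficients cancel up to shifted index [k]; the next one does not, since otherwise [k.+1]
    would contradict the maximality of [k]. *)
Lemma contact_order_sub (K : fieldType) (P1 P2 : {poly K}) :
    P1 != 0 -> P2 != 0 -> mult0 P1 = mult0 P2 -> ~ proportional P1 P2 ->
  has_order (P1 - lead_ratio P1 P2 *: P2) (mult0 P2 + (contact_order P1 P2).+1).
Proof.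
move=> P10 P20 e npr.
have [kP k_max] := contact_orderP P10 P20 e npr.
set mu := lead_ratio P1 P2 in kP k_max *.
set k := contact_order P1 P2 in kP k_max *.
apply/has_orderP; split=> [|i lti]; rewrite coefB coefZ.
  rewrite subr_eq0; apply/negP=> /eqP ek; have := k_max k.+1; rewrite ltnn => H.
  suff : false by []; apply: H => i; rewrite leq_eqVlt => /predU1P[->|/kP//].
  by rewrite /shcoef e.
have [lti'|lei] := ltnP i (mult0 P2).
  by rewrite !coef_lt_mult0 ?e ?mulr0 ?subr0.
have := kP (i - mult0 P2)%N; rewrite /shcoef e subnKC // => -> //.
  by rewrite subrr.
by lia.
Qed.

Lemma has_order_le (K : fieldType) (P : {poly K}) (n : nat) :
  has_order P n -> (n <= (size P).-1)%N.
Proof.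
move=> ordP; have [Pn _] := (has_orderP _ _).1 ordP.
rewrite -ltnS prednK ?size_poly_gt0 ?(has_order_neq0 ordP) // ltnNge.
by apply: contraNN Pn => ?; rewrite nth_default.
Qed.

Lemma contact_order_le (K : fieldType) (P1 P2 : {poly K}) :
    P1 != 0 -> P2 != 0 -> mult0 P1 = mult0 P2 -> ~ proportional P1 P2 ->
  (mult0 P2 + (contact_order P1 P2).+1 <= maxdeg P1 P2)%N.
Proof.
move=> P10 P20 e npr.
have := has_order_le (contact_order_sub P10 P20 e npr) => /leq_trans; apply.
have : (size (P1 - lead_ratio P1 P2 *: P2)%R <= maxn (size P1) (size P2))%N.
  apply: leq_trans (size_polyD _ _) _; rewrite size_polyN geq_max leq_maxl /=.
  by apply: leq_trans (size_scale_leq _ _) (leq_maxr _ _).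
rewrite /maxdeg; lia.
Qed.

(** * The three cases of the formula *)

(** The order of a monomial is affine in the exponent of [P1], with slope [mult0 P1 - mult0 P2 > 0]:
    on each level the orders increase from [nubar] to [nutilde] inside one residue class. *)
Lemma bautin_index_neq_mult (K : fieldType) (F : lacunary_family)
    (P1 P2 : {poly K}) :
    P1 != 0 -> P2 != 0 -> (mult0 P2 < mult0 P1)%N ->
    (forall l l' : 'I_(lmax F).+1, (l' < l)%N ->
       nubar P1 P2 l = nubar P1 P2 l' %[mod mult0 P1 - mult0 P2] ->
       (nutilde P1 P2 l' < nubar P1 P2 l)%N) ->
  bautin_index F P1 P2 = \max_(l < (lmax F).+1) nutilde P1 P2 l.
Proof.
move=> P10 P20 ltnu sep.
pose s (p : lindex F) := (supp_nth (tag p) (tagged p)).-1.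
pose w p := (s p * mult0 P1 + (lexp (tag p) - s p) * mult0 P2)%N.
have valE (n t : nat) : (t <= n)%N -> (t * mult0 P1 + (n - t) * mult0 P2 =
    t * (mult0 P1 - mult0 P2) + n * mult0 P2)%N by move=> ?; nia.
have wE p : w p = (s p * (mult0 P1 - mult0 P2) + lexp (tag p) * mult0 P2)%N.
  by rewrite /w valE ?supp_nth_le.
have monoE l (i j : nat) : (i <= j)%N -> (j < tau l)%N ->
    ((supp_nth l i).-1 <= (supp_nth l j).-1)%N.
  rewrite leq_eqVlt => /predU1P[->//|ltij] ltj; exact/ltnW/supp_pred_lt.
have w_hi p : (w p <= nutilde P1 P2 (tag p))%N.
  rewrite wE /nutilde valE ?supp_nth_le // leq_add2r leq_mul2r.
  rewrite monoE ?orbT ?prednK ?tau_gt0 //.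
  by rewrite -ltnS prednK ?tau_gt0 ?ltn_ord.
have w_inj : injective w.
  apply: (@level_orders_inj F (mult0 P1 - mult0 P2)
    (nubar P1 P2) (nutilde P1 P2)) => //.
  - move=> l i j; rewrite !wE /s /= => /addIn/eqP.
    rewrite eqn_pmul2r ?subn_gt0 // => /eqP; exact: supp_pred_inj.
  - move=> p; rewrite w_hi andbT wE /nubar valE ?supp_nth_le //.
    by rewrite leq_add2r leq_mul2r monoE ?orbT.
  - by move=> p; rewrite wE /nubar valE ?supp_nth_le // !modnMDl.
(* The Kronecker delta selects a single monomial as image. *)
rewrite (@bautin_index_basis K F P1 P2
  (fun p => level_param (fun i => (i == tagged p)%:R)) w) //.
  apply: level_orders_max => // l; exists (last_tau l).
  by rewrite /w /nutilde /s /=.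
move=> p; rewrite lacf_level (bigD1 (tagged p)) //= eqxx scale1r.
rewrite big1 ?addr0 => [|i /negPf->]; last by rewrite scale0r.
by apply: has_orderM; apply: has_orderX; apply: has_order_mult0.
Qed.

(** On each level the orders form an arithmetic progression of step [k.+1] and length [tau l],
    whence the separation modulo [k.+1]. *)
Lemma bautin_index_eq_mult (K : numFieldType) (F : lacunary_family)
    (P1 P2 : {poly K}) (k := contact_order P1 P2) :
    P1 != 0 -> P2 != 0 -> mult0 P1 = mult0 P2 -> ~ proportional P1 P2 ->
    (forall l l' : 'I_(lmax F).+1, (l' < l)%N ->
       mult0 P2 * lexp l = mult0 P2 * lexp l' %[mod k.+1] ->
       (mult0 P2 * lexp l' + k.+1 * (tau l' - 1) < mult0 P2 * lexp l)%N) ->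
  bautin_index F P1 P2 =
  \max_(l < (lmax F).+1) (mult0 P2 * lexp l + k.+1 * (tau l - 1)).
Proof.
move=> P10 P20 e npr sep; set mu := lead_ratio P1 P2.
have mu0 : mu != 0 by rewrite mulf_neq0 ?invr_eq0 ?shcoef0_neq0.
pose w (p : lindex F) := (mult0 P2 * lexp (tag p) + k.+1 * tagged p)%N.
have w_hi p : (w p <= mult0 P2 * lexp (tag p) + k.+1 * (tau (tag p) - 1))%N.
  by rewrite leq_add2l leq_mul2l /= -ltnS subn1 prednK ?tau_gt0 ?ltn_ord.
have w_inj : injective w.
  apply: (@level_orders_inj F k.+1 (fun l => mult0 P2 * lexp l)%N
    (fun l => mult0 P2 * lexp l + k.+1 * (tau l - 1))%N) => //.
  - by move=> l i j /addnI/eqP; rewrite eqn_pmul2l // => /eqP/val_inj.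
  - by move=> p; rewrite w_hi leq_addr.
  - by move=> p; rewrite /w addnC [(k.+1 * _)%N]mulnC modnMDl.
have g_ex p : exists g : lparam K F, has_order (lacf P1 P2 g) (w p).
  case: p => l j; have [c [q qmu pE]] :=
    lacunary_multiple_root j mu0 (@supp_pred_inj F l).
  exists (level_param c); rewrite lacf_level.
  rewrite -(homog_sum c P1 P2 (fun i => supp_nth_le l i)) pE /w /=.
  (* Needed for the cofactor [q] to be homogenized in degree [lexp l - j]. *)
  have jn : (j <= lexp l)%N.
    by apply: leq_trans (tau_le l); rewrite -ltnS subn1 prednK ?tau_gt0.
  have szq : (size q <= (lexp l - j).+1)%N.
    have q0 : q != 0 by apply: contraNneq qmu => ->; rewrite horner0.
    have : (size (\sum_m c m *: 'X^((supp_nth l m).-1) : {poly K})%R <=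
        (lexp l).+1)%N.
      apply: leq_trans (size_sum _ _ _) _; apply/bigmax_leqP=> m _.
      apply: leq_trans (size_scale_leq _ _) _.
      by rewrite size_polyXn ltnS supp_nth_le.
    rewrite pE size_monicM ?monic_exp ?monicXsubC // size_exp_XsubC.
    by move: jn; lia.
  rewrite -{1}(subnKC jn) homog_XsubC_exp //.
  (* Each of the [j] factors [P1 - mu *: P2] has order [mult0 P2 + k.+1]; each remaining degree
     contributes [mult0 P2]. *)
  have -> : (mult0 P2 * lexp l + k.+1 * j =
      j * (mult0 P2 + k.+1) + (lexp l - j) * mult0 P2)%N by nia.
  apply: has_orderM; first exact/has_orderX/contact_order_sub.
  apply: has_order_homog szq qmu (has_order_mult0 P20) _ _.
    have := shcoef0_neq0 P20; rewrite /mu /lead_ratio /shcoef !addn0 e => P2nu.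
    by rewrite divfK.
  by move=> i lti; rewrite coef_lt_mult0 ?e.
have [g gP] : exists g : lindex F -> lparam K F,
    forall p, has_order (lacf P1 P2 (g p)) (w p).
  exact: fin_all_exists g_ex.
rewrite (@bautin_index_basis K F P1 P2 g w) //.
apply: level_orders_max => // l; exists (last_tau l).
by rewrite /w /= subn1.
Qed.

(** Each level collapses to the multiples of one power of [P2], and the positive multiplicity makes
    the orders of these powers distinct. *)
Lemma bautin_index_proportional (K : fieldType) (F : lacunary_family)
    (P1 P2 : {poly K}) : P1 != 0 -> P2 != 0 -> (0 < mult0 P2)%N ->
    proportional P1 P2 ->
  bautin_index F P1 P2 = (mult0 P2 * fdeg F)%N.
Proof.
move=> P10 P20 nu0 [c P1E].
have c0 : c != 0 by apply: contraNneq P10 => c0; rewrite P1E c0 scale0r.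
have monoE (n t : nat) : (t <= n)%N -> P1 ^+ t * P2 ^+ (n - t) = c ^+ t *: P2 ^+ n.
  by move=> letn; rewrite P1E exprZn -scalerAl -exprD subnKC.
pose w (l : 'I_(lmax F).+1) := (lexp l * mult0 P2)%N.
have w_inj : injective w.
  move=> l l' /eqP; rewrite eqn_pmul2r // => /eqP ell.
  by have [/lexp_incr|/lexp_incr|/val_inj//] := ltngtP l l'; rewrite ell ltnn.
rewrite (@bautin_index_span K F P1 P2 _ (fun l => P2 ^+ lexp l) w) //.
- apply/eqP; rewrite eqn_leq; apply/andP; split.
    by apply/bigmax_leqP=> l _; rewrite [leqLHS]mulnC leq_mul2l lexp_le_fdeg orbT.
  by rewrite mulnC; apply: (leq_bigmax (F := w) ord_max).
- by move=> l; apply/has_orderX/has_order_mult0.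
- move=> l; pose i0 := last_tau l.
  (* The denominator cancels the power of [c] brought by [P1]. *)
  exists (level_param (fun i => (i == i0)%:R / c ^+ (supp_nth l i).-1)).
  rewrite lacf_level (bigD1 i0) //= big1 ?addr0 => [|i /negPf->]; last first.
    by rewrite mul0r scale0r.
  by rewrite eqxx monoE ?supp_nth_le // scalerA divfK ?scale1r ?expf_neq0.
move=> lambda; exists (fun l => \sum_(i < tau l)
  (lambda (level_index i) : K) * c ^+ (supp_nth l i).-1).
apply: eq_bigr => l _; rewrite scaler_suml; apply: eq_bigr => i _.
by rewrite monoE ?supp_nth_le // scalerA.
Qed.

Theorem proposition5p12 (R : realType) (P1 P2 : {poly R[i]})
    (F : lacunary_family)
    (P1_neq0 : P1 != 0) (P2_neq0 : P2 != 0)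
    (P1_at0 : P1.[0] = 0) (P2_at0 : P2.[0] = 0)
    (nu1_ge_nu2 : (mult0 P1 >= mult0 P2)%N) :
  let nu1 := mult0 P1 in
  let nu2 := mult0 P2 in
  let nu := nu2 in
  let D := maxdeg P1 P2 in
  let k := contact_order P1 P2 in
  let d := fdeg F in
  let b := bautin_index F P1 P2 in
  [\/ forall l l' : 'I_(lmax F).+1, l' = l.+1 :> nat ->
        (nu * lexp l' > lexp l * D)%N,
      nu1 = nu2 /\
      forall l l' : 'I_(lmax F).+1, l' = l.+1 :> nat ->
        (nu * lexp l' > nu * lexp l + k.+1 * (tau l - 1))%N,
      nu1 <> nu2 /\
      forall l l' : 'I_(lmax F).+1, l' = l.+1 :> nat ->
        (nubar P1 P2 l' > nutilde P1 P2 l)%N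
    | (nu1 = nu2 /\
       forall l l' : 'I_(lmax F).+1, (l > l')%N ->
         (nubar P1 P2 l = nubar P1 P2 l' %[mod k.+1])%N ->
         (nubar P1 P2 l > nubar P1 P2 l' + k.+1 * (tau l' - 1))%N) \/
      (nu1 <> nu2 /\
       forall l l' : 'I_(lmax F).+1, (l > l')%N ->
         (nubar P1 P2 l = nubar P1 P2 l' %[mod `|nu1 - nu2|])%N ->
         (nubar P1 P2 l > nutilde P1 P2 l')%N)] ->
  [/\ nu1 <> nu2 ->
        b = \max_(l < (lmax F).+1) nutilde P1 P2 l,
      nu1 = nu2 -> ~ proportional P1 P2 ->
        b = \max_(l < (lmax F).+1) (nu * lexp l + k.+1 * (tau l - 1))%N
    & proportional P1 P2 ->
        b = nubar P1 P2 (ord_max : 'I_(lmax F).+1) /\ b = (nu * d)%N].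
Proof.
move=> nu1 nu2 nu D k d b lacunary.
have le_nu1D : (nu1 <= D)%N.
  by apply: leq_trans (has_order_le (has_order_mult0 P1_neq0)) (leq_maxl _ _).
have nubarE : nu1 = nu2 ->
    forall l : 'I_(lmax F).+1, nubar P1 P2 l = (nu * lexp l)%N.
  move=> e l; rewrite /nubar -/nu1 e -mulnDl subnKC ?supp_nth_le //.
  by rewrite mulnC.
split=> [ne|e npr|pr].
- have ltnu : (nu2 < nu1)%N.
    by rewrite ltn_neqAle nu1_ge_nu2 eq_sym andbT; apply/eqP.
  have le_s (l : 'I_(lmax F).+1) :
      ((supp_nth l 0).-1 <= (supp_nth l (tau l).-1).-1)%N.
    have [->//|t0] := posnP (tau l).-1.
    by apply/ltnW/supp_pred_lt; rewrite ?prednK ?tau_gt0.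
  have bar_le_tilde (l : 'I_(lmax F).+1) : (nubar P1 P2 l <= nutilde P1 P2 l)%N.
    have := supp_nth_le l (tau l).-1; have := le_s l.
    by move: ltnu; rewrite /nubar /nutilde -/nu1 -/nu2; nia.
  apply: bautin_index_neq_mult => // l l'.
  case: lacunary => [h|[/ne//]|[_ h]|[[/ne//]|[_ h]]].
  + move=> lt_l'l _; apply: (consecutive_lt (hi := nutilde P1 P2)) lt_l'l => //.
    move=> {}l {}l' /h; rewrite -/nu => h'.
    have := supp_nth_le l (tau l).-1; have := supp_nth_le l' 0.
    rewrite /nubar /nutilde -/nu1 -/nu2.
    set s := (supp_nth l _).-1; set s' := (supp_nth l' _).-1 => les' les.
    (* The first condition implies the third: [nutilde] at [l] is at most [lexp l * D], while
       [nubar] at [l'] is at least [nu * lexp l']. *)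
    have hi_le : (s * nu1 + (lexp l - s) * nu2 <= lexp l * D)%N.
      rewrite -[in leqRHS](subnKC les) mulnDl.
      by rewrite leq_add // leq_mul // (leq_trans nu1_ge_nu2).
    apply: leq_ltn_trans hi_le (leq_trans h' _).
    rewrite mulnC -[in leqLHS](subnKC les') mulnDl.
    by rewrite leq_add2r leq_mul2l nu1_ge_nu2 orbT.
  + by move=> lt_l'l _; apply: (consecutive_lt (hi := nutilde P1 P2)) lt_l'l.
  (* Since [nu2 <= nu1], the absolute value in the modulus is the natural subtraction. *)
  + by move=> lt_l'l emod; apply: h => //; rewrite IntDist.distnEl.
- apply: bautin_index_eq_mult => // l l'; rewrite -/nu2 -/nu -/k.
  case: lacunary => [h|[_ h]|[/(_ e)//]|[[_ h]|[/(_ e)//]]].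
  + move=> lt_l'l _; apply: (consecutive_lt (lo := fun l => (nu * lexp l)%N)
      (hi := fun l => (nu * lexp l + k.+1 * (tau l - 1))%N)) lt_l'l
      => [{}l|{}l {}l' /h].
      exact: leq_addr.
    (* The first condition implies the second: [tau l - 1 <= lexp l] and [nu + k.+1 <= D], so the
       top order of level [l] is at most [lexp l * D]. *)
    apply: leq_ltn_trans.
    have := contact_order_le P1_neq0 P2_neq0 e npr.
    rewrite -/nu2 -/nu -/k -/D => kD.
    apply: leq_trans (_ : _ <= lexp l * (nu + k.+1))%N _; last first.
      by rewrite leq_mul2l kD orbT.
    by rewrite mulnDr mulnC leq_add2l mulnC leq_mul2r tau_le orbT.
  + move=> lt_l'l _; apply: (consecutive_lt (lo := fun l => (nu * lexp l)%N)
      (hi := fun l => (nu * lexp l + k.+1 * (tau l - 1))%N)) lt_l'l => // {}l.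
    exact: leq_addr.
  + by move=> lt_l'l emod; have := h l l' lt_l'l; rewrite !nubarE //; apply.
have nu_gt0 : (0 < nu2)%N.
  rewrite lt0n; apply/eqP=> nu0; have [q q0] := has_order_mult0 P2_neq0.
  rewrite -/nu2 nu0 mul1r => P2q; move: q0; rewrite -P2q -horner_coef0 P2_at0.
  by rewrite eqxx.
have bE := bautin_index_proportional F P1_neq0 P2_neq0 nu_gt0 pr.
(* Proportional nonzero polynomials have the same order, so [nubar] at the last level is
   [nu * d]. *)
have e : nu1 = nu2.
  have [c P1E] := pr; apply: (has_order_uniq (has_order_mult0 P1_neq0)).
  have [q q0 P2E] := has_order_mult0 P2_neq0; exists (c *: q).
    rewrite coefZ mulf_neq0 //.
    by apply: contraNneq P1_neq0 => c0; rewrite P1E c0 scale0r.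
  by rewrite P1E {1}P2E scalerAr.
by rewrite nubarE.
Qed.
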